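(* For $n \ge 1$, let $\gamma(n)$ denote the maximum, over all arrangements $\mathcal{A}$ of $n$ distinct lines in $\mathbb{R}^2$, of the minimum size of a guarding set of $\mathcal{A}$. Then $\gamma(n) = n - o(n)$, i.e. $(n-\gamma(n))/n \to 0$ as $n \to \infty$.
   Context: Given a finite set $\mathcal{A}$ of lines in the plane, the cells of the arrangement are the connected components of $\mathbb{R}^2 \setminus \bigcup_{\ell\in\mathcal{A}} \ell$. A cell is bounded by a line $\ell\in\mathcal{A}$ if $\ell$ contains a segment (of positive length) of the boundary of that cell. A guarding set of $\mathcal{A}$ is a subset $S\subseteq \mathcal{A}$ such that every cell of the arrangement is bounded by at least one line of $S$. (The whole set $\mathcal{A}$ is always a guarding set.) *)

(* Defs.v *)
From HB Require Import structures.
From mathcomp Require Import all_boot all_order all_algebra finmap.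
From mathcomp Require Import all_classical all_reals all_analysis.

Set Implicit Arguments.
Unset Strict Implicit.
Unset Printing Implicit Defensive.

Import Order.TTheory GRing.Theory Num.Theory.
Import numFieldNormedType.Exports.

Local Open Scope classical_set_scope.
Local Open Scope ring_scope.

Section Arrangements.
Variable R : realType.

Definition is_line (l : set (R * R)) : Prop :=
  exists a b c : R,
    (a, b) <> (0, 0) /\ l = [set p | a * p.1 + b * p.2 = c].

Definition arrangement (A : {fset set (R * R)}) : Prop :=
  forall l, l \in A -> is_line l.

Definition cell (A : {fset set (R * R)}) (C : set (R * R)) : Prop :=
  let D := ~` \bigcup_(l in [set` A]) l in
  exists2 x, D x & C = connected_component D x.

Definition boundary (T : topologicalType) (C : set T) : set T :=
  closure C `\` C°.

Definition segment (p q : R * R) : set (R * R) :=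
  [set (1 - t) *: p + t *: q | t in `[0, 1]].

Definition bounded_by (C l : set (R * R)) : Prop :=
  exists p q : R * R, p <> q /\ segment p q `<=` l `&` boundary C.

Definition guarding (A S : {fset set (R * R)}) : Prop :=
  (S `<=` A)%fset /\
  forall C, cell A C -> exists2 l, l \in S & bounded_by C l.

(* The default value #|` A| of the minimum plays no role as soon as A guards
   itself, which holds for every nonempty arrangement; see guard_numP. *)
Definition guard_num (A : {fset set (R * R)}) : nat :=
  \big[minn/#|` A|]_(S <- fpowerset A | `[< guarding A S >]) #|` S|.

(* The values range over k <= n because guard_num A <= #|` A|, so this is the
   maximum over all arrangements of n lines; see gammaP. *)
Definition gamma (n : nat) : nat :=
  \max_(k < n.+1 | `[< exists A : {fset set (R * R)},
      [/\ arrangement A, #|` A| = n & guard_num A = k] >]) k.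

Lemma guard_num_le (A : {fset set (R * R)}) : (guard_num A <= #|` A|)%N.
Proof.
rewrite /guard_num; elim/big_rec: _ => // S k _ kA.
exact: leq_trans (geq_minr _ _) kA.
Qed.

Lemma guard_numP (A : {fset set (R * R)}) : guarding A A ->
  (exists2 S, guarding A S & #|` S| = guard_num A) /\
  (forall S, guarding A S -> (guard_num A <= #|` S|)%N).
Proof.
move=> AA; split.
  rewrite /guard_num; elim/big_rec: _ => [|S k /asboolP AS [T AT <-]].
    by exists A.
  by case: (leqP #|` S| #|` T|) => ST; [exists S|exists T].
move=> S AS; have : S \in enum_fset (fpowerset A) by rewrite fpowersetE; case: AS.
rewrite /guard_num; elim: (enum_fset _) => // T s IH.
rewrite inE big_cons => /orP[/eqP<-|/IH sS].
  by rewrite asboolT// geq_minl.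
by case: ifP => // _; exact: leq_trans (geq_minr _ _) sS.
Qed.

Lemma gammaP (n : nat) :
  (exists A : {fset set (R * R)},
     [/\ arrangement A, #|` A| = n & guard_num A = gamma n]) /\
  (forall A : {fset set (R * R)}, arrangement A -> #|` A| = n ->
     (guard_num A <= gamma n)%N).
Proof.
have le_gamma (A : {fset set (R * R)}) : arrangement A -> #|` A| = n ->
    (guard_num A <= gamma n)%N.
  move=> lA cA; have kn : (guard_num A < n.+1)%N by rewrite ltnS -cA guard_num_le.
  apply: (@leq_bigmax_cond _ _ (fun k : 'I_n.+1 => k : nat) (Ordinal kn)).
  by apply/asboolP; exists A.
split=> //.
pose f (i : nat) : set (R * R) := [set p | 1 * p.1 + 0 * p.2 = i%:R].
have f_inj : injective f.
  move=> i j fij; have : f i (i%:R, 0) by rewrite /f /= mul1r mul0r addr0.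
  by rewrite fij /f /= mul1r mul0r addr0 => /eqP; rewrite eqr_nat => /eqP.
pose A := [fset x in [seq f i | i <- iota 0 n]]%fset.
have lA : arrangement A.
  move=> l; rewrite inE => /mapP[i _ ->]; exists 1, 0, i%:R; split=> //.
  by case=> /eqP; rewrite oner_eq0.
have cA : #|` A| = n.
  have u : uniq [seq f i | i <- iota 0 n].
    by rewrite (map_inj_uniq f_inj) iota_uniq.
  by rewrite card_fseq (undup_id u) size_map size_iota.
have kn : (guard_num A < n.+1)%N by rewrite ltnS -cA guard_num_le.
pose P := [pred k : 'I_n.+1 | `[< exists A : {fset set (R * R)},
  [/\ arrangement A, #|` A| = n & guard_num A = k] >]].
have P0 : (0 < #|P|)%N.
  by apply/card_gt0P; exists (Ordinal kn); apply/asboolP; exists A.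
have [k] := eq_bigmax_cond (fun k : 'I_n.+1 => k : nat) P0.
move=> /asboolP[B [lB cB kB]] gk; exists B; split=> //.
by rewrite kB -gk; exact: eq_bigl.
Qed.

End Arrangements.

(* Main.v *)
Require Import Defs.
From mathcomp Require Import all_boot all_order all_algebra finmap.
From mathcomp Require Import all_classical all_reals all_analysis.
From mathcomp Require Import ring lra.
Import Order.TTheory GRing.Theory Num.Theory.
Import numFieldNormedType.Exports.
Local Open Scope classical_set_scope.
Local Open Scope ring_scope.

Set Implicit Arguments.
Unset Strict Implicit.
Unset Printing Implicit Defensive.

(* Take base lines [L_t] indexed by words [t], and replace each one by a bundle
   of [m] nearby lines [L_t + e * h_a], where [h_a x = a * x - a ^ 2].  Just to
   the right of [x = a + b], the lines [a] and [b] of every bundle are adjacent.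
   The [L_t] are chosen so that two words differing only in their letter of
   index [c] give base lines that cross at an abscissa in [(c, c + 1)], at a
   point lying on no other base line.  If moreover [c = a + b], then for small
   [e] the four lines [(t, a), (t, b), (s, a), (s, b)] enclose a quadrilateral
   that no other line touches, so a guarding set contains one of these four.
   Finally, for a large alphabet, a set of more than [2 / m] of all the lines
   contains four such lines: it meets many bundles in two lines, by pigeonhole
   often with the same pair [a, b], and among the corresponding words two differ
   only in the letter of index [a + b].  Hence the complement of a guarding set
   has at most [2 / m] of the lines.  One extra letter from an alphabet of free
   size serves to reach every large number of lines. *)

(** * Counting sets of lines without quadrilaterals *)

Definition word (C k q : nat) : finType := ({ffun 'I_C -> 'I_k} * 'I_q)%type.

(* Index [C], and every larger one, reads the last component. *)
Definition digit (C k q : nat) (t : word C k q) (c : nat) : nat :=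
  if insub c is Some i then t.1 i else t.2.

Lemma digit_inj (C k q : nat) (t s : word C k q) :
  (forall c, (c < C.+1)%N -> digit t c = digit s c) -> t = s.
Proof.
case: t s => [f i] [g j] e; congr (_, _).
  apply/ffunP => c; apply/val_inj; have := e c (ltnW (ltn_ord c)).
  by rewrite /digit valK.
by apply/val_inj; have := e C (leqnn _); rewrite /digit insubN ?ltnn.
Qed.

Definition agree_off (C k q : nat) (c : nat) (t s : word C k q) : Prop :=
  forall d, d != c -> digit t d = digit s d.

(** Overwriting the letter of index [c] by each of the [k] values is injective on pairs, because two
    members of [A] that collide agree off [c]. *)
Lemma card_agree_off_free (C k q c : nat) (A : {set word C k q}) : (c < C)%N ->
  {in A &, forall t s, agree_off c t s -> t = s} ->
  (#|A| * k <= #|{: word C k q}|)%N.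
Proof.
move=> cC Ainj; pose c0 := Ordinal cC.
pose g (x : word C k q * 'I_k) : word C k q :=
  ([ffun d => if d == c0 then x.2 else x.1.1 d], x.1.2).
rewrite -[X in (_ * X)%N]card_ord -[#|'I_k|]cardsT -cardsX.
rewrite -(@card_in_imset _ _ g) ?max_card// => [[t v] [s v']].
rewrite !inE /= !andbT => tA sA [/ffunP e e2].
have := e c0; rewrite !ffunE eqxx => <-; congr (_, _).
apply: Ainj => // d dc; rewrite /digit; case: insubP => [i _ id|_]; last by rewrite e2.
have ic : (i == c0) = false.
  by apply/negbTE; apply: contra dc => /eqP ic; rewrite -id ic.
by have := e i; rewrite !ffunE ic => ->.
Qed.

Lemma card_quad_free (C k q m : nat) (S : {set word C k q * 'I_m}) :
  (m + m <= C)%N -> (m * m <= k)%N ->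
  (forall t s (a b : 'I_m), a != b -> t != s -> agree_off (a + b) t s ->
     (t, a) \in S -> (t, b) \in S -> (s, a) \in S -> (s, b) \in S -> False) ->
  (#|S| <= 2 * #|{: word C k q}|)%N.
Proof.
move=> mC mk free; set W := word C k q in S free *.
pose I (a b : 'I_m) := [set t : W | [&& a != b, (t, a) \in S & (t, b) \in S]]%SET.
pose f (t : W) (a : 'I_m) : nat := (t, a) \in S.
have -> : #|S| = (\sum_t \sum_a f t a)%N.
  rewrite -sum1_card pair_bigA /= big_mkcond; apply: eq_bigr => -[t a] _ /=.
  by rewrite /f; case: (_ \in _).
(* Fix one [a] with [(t, a)] in [S]; each further element of the fibre forms a pair with [a]. *)
have fibre (t : W) : (\sum_a f t a <= 1 + \sum_a \sum_b (t \in I a b))%N.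
  have [/existsP[a ta]|/existsPn none] := boolP [exists a, (t, a) \in S]; last first.
    by rewrite big1 // => a _; rewrite /f (negbTE (none a)).
  rewrite (bigD1 a) //= {1}/f ta leq_add2l.
  rewrite [X in (_ <= X)%N](bigD1 a) //=.
  apply: leq_trans (leq_addr _ _); rewrite [X in (_ <= X)%N](bigID (fun b => b != a)) /=.
  apply: leq_trans (leq_addr _ _); apply: leq_sum => b ba.
  by rewrite /f inE eq_sym ba ta.
apply: (@leq_trans (\sum_(t : W) (1 + \sum_a \sum_b (t \in I a b)))%N).
  by apply: leq_sum => t _; apply: fibre.
rewrite big_split /= sum1_card mul2n -addnn leq_add2l exchange_big /=.
(* Two words of [I a b] differing only at index [a + b] would form a forbidden configuration. *)
have small (a b : 'I_m) : (#|I a b| * (m * m) <= #|{: W}|)%N.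
  apply: leq_trans (leq_mul (leqnn _) mk) _.
  apply: (@card_agree_off_free _ _ _ (a + b)).
    by rewrite (leq_trans _ mC)// -addnS leq_add// ltnW.
  move=> t s; rewrite !inE => /and3P[ab ta tb] /and3P[_ sa sb] ts.
  by have [//|ne] := eqVneq t s; have := free t s a b ab ne ts ta tb sa sb.
have [m0|m0] := posnP m; first by rewrite big1 // => a _;
  have := ltn_ord a; rewrite [X in (_ < X)%N]m0.
rewrite -(@leq_pmul2r (m * m)) ?muln_gt0 ?m0//.
have -> : (\sum_(a < m) \sum_t \sum_(b < m) (t \in I a b) =
    \sum_(a < m) \sum_(b < m) #|I a b|)%N.
  apply: eq_bigr => a _; rewrite exchange_big; apply: eq_bigr => b _.
  by rewrite -sum1_card [RHS]big_mkcond; apply: eq_bigr => t _; case: (_ \in _).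
rewrite big_distrl /= (leq_trans (n := (\sum_(a < m) \sum_(b < m) #|{: W}|)%N)) //.
  by apply: leq_sum => a _; rewrite big_distrl; apply: leq_sum.
by rewrite !sum_nat_const card_ord mulnA mulnC.
Qed.

(** * Generic values and small parameters *)

(** The product of the nonzero [p i] has fewer roots than its size, so some natural number below
    that size is not a root. *)
Lemma avoid_roots (R : numDomainType) (I : finType) (p : I -> {poly R}) :
  exists x : R, forall i, p i != 0 -> (p i).[x] != 0.
Proof.
pose P := \prod_(i | p i != 0) p i.
have P0 : P != 0 by apply/prodf_neq0.
have [k Pk] : exists k : 'I_(size P), ~~ root P k%:R.
  apply/existsP; apply: contraT => /existsPn all_roots.
  have := @max_poly_roots _ P [seq (nat_of_ord i)%:R | i <- enum 'I_(size P)] P0.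
  rewrite size_map size_enum_ord ltnn; apply.
    by apply/allP => _ /mapP[i _ ->]; have := all_roots i; rewrite negbK.
  rewrite map_inj_uniq ?enum_uniq// => i j /eqP; rewrite eqr_nat => /eqP.
  exact: val_inj.
exists k%:R => i pi0; apply: contraNneq Pk => pik.
by rewrite /root horner_prod (bigD1 i)//= pik mul0r.
Qed.

Definition eventually_small (R : realFieldType) (P : R -> Prop) : Prop :=
  exists2 e0 : R, 0 < e0 & forall e, 0 < e -> e < e0 -> P e.

Section EventuallySmall.
Variable R : realFieldType.
Implicit Types P Q : R -> Prop.

Lemma small_imply P Q :
  (forall e, 0 < e -> P e -> Q e) -> eventually_small P -> eventually_small Q.
Proof. by move=> PQ [e0 e00 H]; exists e0 => // e e1 e2; apply: PQ => //; apply: H. Qed.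

Lemma small_true P : (forall e, 0 < e -> P e) -> eventually_small P.
Proof. by move=> H; exists 1 => // e e0 _; apply: H. Qed.

Lemma small_and P Q : eventually_small P -> eventually_small Q ->
  eventually_small (fun e => P e /\ Q e).
Proof.
move=> [e1 e10 H1] [e2 e20 H2]; exists (Num.min e1 e2).
  by rewrite lt_min e10.
by move=> e e0; rewrite lt_min => /andP[? ?]; split; [apply: H1|apply: H2].
Qed.

Lemma small_forall (I : finType) (P : I -> R -> Prop) :
  (forall i, eventually_small (P i)) -> eventually_small (fun e => forall i, P i e).
Proof.
move=> H.
suff: forall s : seq I, eventually_small (fun e => forall i, i \in s -> P i e).
  move=> /(_ (enum I)); apply: small_imply => e _ He i.
  by apply: He; rewrite mem_enum.
elim=> [|i s IH]; first exact: small_true.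
apply: small_imply (small_and (H i) IH) => e _ [Pi Ps] j.
by rewrite inE => /predU1P[->//|]; apply: Ps.
Qed.

Lemma small_lt (K c : R) : 0 < c -> eventually_small (fun e => e * K < c).
Proof.
move=> c0; exists (c / (1 + `|K|)); first by rewrite divr_gt0// ltr_wpDr.
move=> e e0; rewrite ltr_pdivlMr ?ltr_wpDr// => H.
apply: le_lt_trans H; rewrite ler_pM2l//.
by rewrite (le_trans (ler_norm K))// lerDr.
Qed.

End EventuallySmall.

(** * Betweenness and tangents to a parabola *)

Lemma between (R : realDomainType) (z u v lo hi : R) :
  (z - u) * (z - v) <= 0 -> lo <= u -> lo <= v -> u <= hi -> v <= hi ->
  lo <= z <= hi.
Proof.
move=> zuv lu lv uh vh; apply/andP; split; rewrite leNgt; apply/negP => zM.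
- have := @mulr_gt0 _ (u - z) (v - z); rewrite !subr_gt0.
  move=> /(_ (lt_le_trans zM lu) (lt_le_trans zM lv)); lra.
- have := @mulr_gt0 _ (z - u) (z - v); rewrite !subr_gt0.
  move=> /(_ (le_lt_trans uh zM) (le_lt_trans vh zM)); lra.
Qed.

Lemma between_norm_le (R : realDomainType) (z u v M : R) :
  (z - u) * (z - v) <= 0 -> `|u| <= M -> `|v| <= M -> `|z| <= M.
Proof.
move=> zuv; rewrite !ler_norml => /andP[u1 u2] /andP[v1 v2].
exact: between zuv _ _ _ _.
Qed.

Lemma between_dist_le (R : realDomainType) (z w u v : R) :
  (z - u) * (z - v) <= 0 -> (w - u) * (w - v) <= 0 -> `|z - w| <= `|u - v|.
Proof.
wlog uv : u v / u <= v => [H|] zuv wuv.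
  have [|/ltW vu] := leP u v; first by move/H; apply.
  by rewrite [X in _ <= X]distrC; apply: H; rewrite // mulrC.
have /andP[z1 z2] := between zuv (lexx u) uv uv (lexx v).
have /andP[w1 w2] := between wuv (lexx u) uv uv (lexx v).
rewrite [X in _ <= X]distrC [X in _ <= X]ger0_norm ?subr_ge0//.
by rewrite ler_norml; apply/andP; split; lra.
Qed.

(** A nonzero integer keeps its sign when shifted by [s] in [(0, 1)]. *)
Lemma natr_sub_far (R : realDomainType) (d a : nat) (s : R) : d <> a ->
  0 < s -> s < 1 -> 0 < (d%:R - a%:R) * (d%:R - a%:R - s).
Proof.
move=> da s0 s1; have [lt|lt|//] := ltngtP d a.
- have : d%:R + 1 <= a%:R :> R by rewrite natr1 ler_nat.
  by move=> h; nra.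
- have : a%:R + 1 <= d%:R :> R by rewrite natr1 ler_nat.
  by move=> h; nra.
Qed.

(* The lines [y = tangent a x] are tangent to a parabola, and lines [a] and [b]
   meet at [x = a + b]; just to the right of that abscissa they are adjacent. *)
Definition tangent (R : pzRingType) (a : nat) (x : R) : R := a%:R * x - a%:R ^+ 2.

Lemma tangent_adjacent (R : realDomainType) (a b d : nat) (x : R) :
  (a + b)%:R < x -> x < (a + b)%:R + 1 ->
  (tangent d x - tangent a x) * (tangent d x - tangent b x) <= 0 ->
  d = a \/ d = b.
Proof.
rewrite natrD => x1 x2 H.
have [->|da] := eqVneq d a; first by left.
have [->|db] := eqVneq d b; first by right.
exfalso; set s := x - (a%:R + b%:R).
have s0 : 0 < s by rewrite /s subr_gt0.
have s1 : s < 1 by rewrite /s; lra.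
(* As [x = a + b + s], the two differences are [- (d - a) * (d - b - s)] and
   [- (d - b) * (d - a - s)]; their product regroups into two positive factors. *)
have pa := natr_sub_far (elimN eqP da) s0 s1.
have pb := natr_sub_far (elimN eqP db) s0 s1.
have := mulr_gt0 pa pb; rewrite ltNge => /negP; apply.
by move: H; congr (_ <= 0); rewrite /tangent /s; ring.
Qed.

(** * The quadrilateral near one crossing *)

(** Used with [D] the slope difference of two base lines and the right side the gap between lines
    [a] and [b] of a bundle. The distance from [x] to [c] is at most that to [x0] plus [1]; for
    small [e], half of the left side absorbs the former, whence the factor [2]. *)
Lemma small_crossing (R : realFieldType) (D c x0 N : R) : D != 0 -> 0 <= N ->
  c < x0 -> x0 < c + 1 ->
  eventually_small (fun e => forall x,
    `|D * (x - x0)| <= e * (N * `|x - c|) ->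
    [/\ `|x - x0| <= e * (2 * N / `|D|), c < x & x < c + 1]).
Proof.
move=> D0 N0 cx xc; have aD : 0 < `|D| by rewrite normr_gt0.
have [cx' xc'] : 0 < x0 - c /\ 0 < c + 1 - x0 by rewrite !subr_gt0.
have := small_and (small_lt (2 * N) aD)
  (small_and (small_lt (2 * N / `|D|) cx') (small_lt (2 * N / `|D|) xc')).
apply: small_imply => e e0 [h1 [h2 h3]] x; rewrite normrM => H.
have tri : `|x - c| <= `|x - x0| + 1.
  rewrite (_ : x - c = (x - x0) + (x0 - c)); last by ring.
  rewrite (le_trans (ler_normD _ _))// lerD2l ger0_norm ?ltW//; lra.
have close : `|x - x0| <= e * (2 * N / `|D|).
  rewrite mulrA ler_pdivlMr// mulrC.
  have eN : 0 <= e * N by rewrite mulr_ge0// ltW.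
  have nx : 0 <= `|x - x0| by [].
  have H3 : `|D| * `|x - x0| <= e * N * (`|x - x0| + 1).
    by rewrite (le_trans H)// -mulrA !ler_wpM2l// ltW.
  nra.
split=> //; have := le_lt_trans close h2; have := le_lt_trans close h3;
  rewrite !ltr_norml => /andP[? ?] /andP[? ?]; lra.
Qed.

(** Signed vertical offset of [p] from a bundle line; residuals of opposite signs put [p] strictly
    between two lines. *)
Definition residual (R : pzRingType) (A B e : R) (a : nat) (p : R * R) : R :=
  p.2 - (A * p.1 + B) - e * tangent a p.1.

(* For small [e] the lines [y = A t * x + B t + e * tangent a x] indexed by
   [{t, t'} x {a, b}] enclose a quadrilateral near the crossing of [t] and [t']. *)
Lemma small_quad (R : realFieldType) (W : finType) (A B : W -> R) (m : nat)
    (t t' : W) (a b : 'I_m) (x0 : R) :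
  A t != A t' -> a != b -> A t * x0 + B t = A t' * x0 + B t' ->
  (a + b)%:R < x0 -> x0 < (a + b)%:R + 1 ->
  (forall s, s != t -> s != t' -> A s * x0 + B s != A t * x0 + B t) ->
  eventually_small (fun e =>
    let G s (d : 'I_m) := residual (A s) (B s) e d in
    (exists p, G t a p * G t b p < 0 /\ G t' a p * G t' b p < 0) /\
    (forall p, G t a p * G t b p <= 0 -> G t' a p * G t' b p <= 0 ->
      forall s d, G s d p = 0 ->
      ((s == t) || (s == t')) && ((d == a) || (d == b)))).
Proof.
move=> AA ab cross x1 x2 generic.
set c : R := (a + b)%:R in x1 x2; set D := A t - A t'.
have D0 : D != 0 by rewrite subr_eq0.
have tangentB x : tangent a x - tangent b x = (a%:R - b%:R) * (x - c) :> R.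
  by rewrite /tangent /c natrD; ring.
set N : R := `|a%:R - b%:R|.
(* On the quadrilateral, [e * K] will bound the distance from [x] to [x0], and [e * H] the size of
   [e * tangent d x], since [0 <= x <= 2 * m + 1]. *)
set K := 2 * N / `|D|; set H : R := m%:R * (2 * m%:R + 1).
have third s : eventually_small (fun e => s != t -> s != t' ->
    e * (2 * H + K * `|A t - A s|) < `|A t * x0 + B t - (A s * x0 + B s)|).
  have [->|st] := eqVneq s t; first exact: small_true.
  have [->|st'] := eqVneq s t'; first exact: small_true.
  have pos : 0 < `|A t * x0 + B t - (A s * x0 + B s)|.
    by rewrite normr_gt0 subr_eq0 eq_sym generic.
  by apply: small_imply (small_lt (2 * H + K * `|A t - A s|) pos) => e _ h _ _.
have := small_and (small_crossing D0 (normr_ge0 (a%:R - b%:R)) x1 x2) (small_forall third).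
apply: small_imply => e e0 [near far]; split.
  have hab : tangent a x0 - tangent b x0 != 0.
    rewrite tangentB mulf_neq0// subr_eq0 ?eqr_nat//.
    by rewrite gt_eqF.
  have sq : 0 < e ^+ 2 * (tangent a x0 - tangent b x0) ^+ 2.
    by apply: mulr_gt0; [exact: exprn_gt0|rewrite exprn_even_gt0].
  (* At [x0] the two bundles coincide; this point is midway between lines [a] and [b]. *)
  exists (x0, A t * x0 + B t + e * ((tangent a x0 + tangent b x0) / 2)).
  by rewrite /residual /= -cross; split; nra.
move=> [x y]; rewrite /residual /=.
set z := y - (A t * x + B t); set z' := y - (A t' * x + B t').
move=> hz hz' s d.
have zz' : z' - z = D * (x - x0).
  by rewrite /z /z' /D; move: cross => /(congr1 (fun u => u - A t' * x0 - B t)); lra.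
(* Both [z] and [z'] lie between [e * tangent a x] and [e * tangent b x], which bounds their
   difference. *)
have [xx0 cx xc] : [/\ `|x - x0| <= e * K, c < x & x < c + 1].
  apply: near; rewrite -zz' (le_trans (between_dist_le hz' hz))//.
  by rewrite -mulrBr tangentB !normrM (gtr0_norm e0).
have inside w : (w - e * tangent a x) * (w - e * tangent b x) <= 0 ->
    w = e * tangent d x -> (d == a) || (d == b).
  move=> hw we; apply/orP.
  have : (tangent d x - tangent a x) * (tangent d x - tangent b x) <= 0.
    move: hw; rewrite we -!mulrBr mulrACA pmulr_rle0// mulr_gt0//.
  by case/(tangent_adjacent cx xc) => /val_inj ->; rewrite eqxx; [left|right].
move=> /eqP; rewrite subr_eq0 => /eqP Gs.
have [st|st] := eqVneq s t; first by rewrite st in Gs; rewrite (inside z).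
have [st'|st'] := eqVneq s t'; first by rewrite st' in Gs; rewrite (inside z').
(* A line of a third bundle through the point would force its base line closer to that of [t] at
   [x0] than [far] permits. *)
exfalso; have := far s st st'; rewrite ltNge => /negP; apply.
have bound (i : 'I_m) : `|e * tangent i x| <= e * H.
  rewrite normrM gtr0_norm// ler_pM2l// /tangent expr2 -mulrBr normrM normr_nat.
  apply: ler_pM => //; first by rewrite ler_nat ltnW.
  have ai : a%:R <= m%:R :> R by rewrite ler_nat ltnW.
  have bi : b%:R <= m%:R :> R by rewrite ler_nat ltnW.
  have ii : i%:R <= m%:R :> R by rewrite ler_nat ltnW.
  have i0 : 0 <= i%:R :> R by [].
  have c0 : 0 <= c by [].
  have cE : c = a%:R + b%:R by rewrite /c natrD.
  by rewrite ler_norml; apply/andP; split; lra.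
have zH := between_norm_le hz (bound a) (bound b).
rewrite (_ : A t * x0 + B t - (A s * x0 + B s) =
  (e * tangent d x - z) - (A t - A s) * (x - x0)); last by rewrite -Gs /z; ring.
apply: le_trans (ler_normB _ _) _; rewrite [X in _ <= X]mulrDr; apply: lerD.
  by rewrite (le_trans (ler_normB _ _))// (_ : e * (2 * H) = e * H + e * H) ?lerD//; ring.
by rewrite normrM mulrA [X in _ <= X]mulrC ler_wpM2l.
Qed.

(** * Generic base lines *)

Lemma digit_lt (C k q : nat) (t : word C k q) (c : nat) : (digit t c < k + q)%N.
Proof.
rewrite /digit; case: insubP => [i _ _|_].
  by rewrite (leq_trans (ltn_ord _))// leq_addr.
by rewrite (leq_trans (ltn_ord _))// leq_addl.
Qed.

(* [A t] and [B t] are the values at a generic [T] of polynomials giving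
   [A t * x + B t = \sum_d T ^+ d * u_d * (x - d - eta * u_d)], with [u_d] the
   digits of [t]; changing only [u_c] into [v_c] moves the line around the point
   of abscissa [c + eta * (u_c + v_c)]. *)
Lemma generic_lines (R : realFieldType) (C k q : nat) :
  exists A B : word C k q -> R, injective A /\
  forall t s c, (c < C)%N -> t != s -> agree_off c t s ->
  exists x0, [/\ c%:R < x0, x0 < c%:R + 1, A t * x0 + B t = A s * x0 + B s &
    forall r, r != t -> r != s -> A r * x0 + B r != A t * x0 + B t].
Proof.
set W := word C k q; pose u (t : W) d : R := (digit t d)%:R.
(* Digits are below [k + q], so [eta] times a sum of two digits is below [1]. *)
pose eta : R := (2 * (k + q)%:R)^-1.
pose pA t : {poly R} := \poly_(d < C.+1) u t d.
pose pB t : {poly R} := \poly_(d < C.+1) - (u t d * (d%:R + eta * u t d)).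
pose pL r t x := x *: (pA r - pA t) + (pB r - pB t).
have coef_pL r t x d : (d < C.+1)%N ->
    (pL r t x)`_d = (u r d - u t d) * (x - d%:R - eta * (u r d + u t d)).
  by move=> dC; rewrite /pL coefD coefZ !coefB !coef_poly dC; ring.
have u_inj t s d : u t d = u s d -> digit t d = digit s d.
  by move/eqP; rewrite eqr_nat => /eqP.
have eta_sum (t s : W) d : 0 <= eta * (u t d + u s d) < 1.
  have kq : 0 < (k + q)%:R :> R by rewrite ltr0n (leq_trans _ (digit_lt t d)).
  rewrite mulr_ge0 ?addr_ge0 ?invr_ge0 ?mulr_ge0//= /eta mulrC ltr_pdivrMr ?mulr_gt0//.
  by rewrite mul1r mulr_natl mulr2n ltrD// ltr_nat digit_lt.
pose X t s (c : 'I_C) := c%:R + eta * (u t c + u s c).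
(* Vanishing at [T] means, on the left, equal slopes; on the right, that lines [r] and [t] meet at
   abscissa [X t s c]. *)
pose avoid (i : W * W + W * W * W * 'I_C) : {poly R} :=
  match i with
  | inl (t, s) => pA t - pA s
  | inr (t, s, r, c) => pL r t (X t s c)
  end.
have [T HT] := avoid_roots avoid.
exists (fun t => (pA t).[T]), (fun t => (pB t).[T]); split.
  move=> t s ts; apply: digit_inj => c cC; apply: u_inj.
  have := HT (inl (t, s)); rewrite /= hornerD hornerN ts subrr eqxx.
  have [/eqP|_ /(_ isT)//] := eqVneq (pA t - pA s) 0.
  by rewrite subr_eq0 => /eqP/(congr1 (fun p : {poly R} => p`_c)); rewrite !coef_poly cC.
move=> t s c0 cC ts off; pose c := Ordinal cC.
have off' d : d != c :> nat -> u t d = u s d by move=> dc; rewrite /u off.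
have uc : digit t c != digit s c.
  apply: contra ts => /eqP tc; apply/eqP/digit_inj => d _.
  by have [->|/off] := eqVneq d c.
have /andP[X0 X1] := eta_sum t s c.
have horner_pL r x : (pL r t x).[T] =
    (pA r).[T] * x + (pB r).[T] - ((pA t).[T] * x + (pB t).[T]).
  by rewrite /pL hornerD hornerZ !hornerD !hornerN; ring.
exists (X t s c); split.
- have kq : 0 < (k + q)%:R :> R by rewrite ltr0n (leq_trans _ (digit_lt t c)).
  rewrite ltrDl mulr_gt0 ?invr_gt0 ?mulr_gt0// /u -natrD ltr0n.
  by move: uc; case: (digit t c) (digit s c) => [|?] [|?].
- by rewrite /X ltrD2l.
- apply/esym/eqP; rewrite -subr_eq0 -horner_pL (_ : pL s t _ = 0) ?horner0//.
  apply/polyP => d; rewrite coef0; have [dC|dC] := ltnP d C.+1; last first.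
    by rewrite /pL coefD coefZ !coefB !coef_poly ltnNge dC /= !subr0 mulr0 addr0.
  rewrite coef_pL//; have [->|dc] := eqVneq d c; first by rewrite /X; ring.
  by rewrite (off' d dc) subrr mul0r.
move=> r rt rs; rewrite -subr_eq0 -horner_pL.
(* If this polynomial were zero, comparing integer parts of abscissas would make [r] agree with [t]
   off [c], and cancelling [eta] would make its digit at [c] that of [t] or [s]; so [r] would be [t]
   or [s]. *)
apply: (HT (inr (t, s, r, c))) => /=; apply: contraNneq rt => pL0.
have zero d : (d < C.+1)%N -> u r d = u t d \/ X t s c = d%:R + eta * (u r d + u t d).
  move=> dC; have /eqP := coef_pL r t (X t s c) d dC.
  rewrite pL0 coef0 eq_sym mulf_eq0 subr_eq0 => /orP[/eqP|/eqP h]; [by left|right].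
  by lra.
have same d : (d < C.+1)%N -> d != c :> nat -> digit r d = digit t d.
  move=> dC dc; have [/u_inj//|] := zero d dC.
  have /andP[h0 h1] := eta_sum r t d; rewrite /X => e.
  exfalso; have : c%:R < (d%:R + 1 : R) by lra.
  have : d%:R < (c%:R + 1 : R) by lra.
  rewrite !natr1 !ltr_nat !ltnS => dc1 cd1; case/negP: dc.
  by rewrite eqn_leq dc1.
have [rc|] := zero c (ltnW (ltn_ord c)).
  apply/eqP/digit_inj => d dC; have [->|dc] := eqVneq d c; first exact: u_inj.
  exact: same.
have eta0 : eta != 0.
  rewrite invr_eq0 mulf_neq0 ?pnatr_eq0// -lt0n.
  exact: leq_trans (digit_lt t c).
move=> /addrI/(mulfI eta0); rewrite addrC => /addIr/u_inj sr.
case/eqP: rs; apply/digit_inj => d dC; have [->//|dc] := eqVneq d c.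
by rewrite same// off.
Qed.

(** * Signs of residuals on a cell and its closure *)

Section Plane.
Variable R : realType.
Implicit Types (A G : {fset set (R * R)}) (F : R * R -> R).

(** The image of the component under [F] is an interval, and it misses [0] because the zero set of
    [F] belongs to [A]. *)
Lemma connected_component_sign A F (x p : R * R) : continuous F ->
  [set y | F y = 0] \in A ->
  let D := ~` \bigcup_(l in [set` A]) l in
  D x -> connected_component D x p -> 0 < F x * F p.
Proof.
move=> cF FA D Dx Dxp; rewrite ltNge; apply/negP => neg.
have conn : connected (F @` connected_component D x).
  apply: connected_continuous_connected; first exact: component_connected.
  exact: continuous_subspaceT.
have Fx : (F @` connected_component D x) (F x).
  by exists x => //; exact: connected_component_refl.
have Fp : (F @` connected_component D x) (F p) by exists p.
have [y Dy Fy0] : (F @` connected_component D x) 0.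
  move/connected_intervalP: conn => itv; have [Fx0|Fx0] := leP (F x) 0.
    have [Fp0|Fp0] := leP 0 (F p); first by apply: itv Fx Fp 0 _; rewrite Fx0.
    have [Fx00|ne] := eqVneq (F x) 0; first by exists x => //; exact: connected_component_refl.
    have : F x < 0 by rewrite lt_neqAle ne.
    by move=> /(fun h => nmulr_rgt0 (F p) h); rewrite Fp0 ltNge neg.
  apply: (itv _ _ Fp Fx); rewrite (ltW Fx0) andbT.
  by move: neg; rewrite pmulr_rle0.
by have := connected_component_sub Dy; apply; exists [set z | F z = 0].
Qed.

(** Each factor keeps its sign on the component, and the weak inequality is a closed condition. *)
Lemma closure_component_quad A F1 F2 (x p : R * R) :
  continuous F1 -> continuous F2 ->
  [set y | F1 y = 0] \in A -> [set y | F2 y = 0] \in A ->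
  let D := ~` \bigcup_(l in [set` A]) l in
  D x -> F1 x * F2 x < 0 -> closure (connected_component D x) p ->
  F1 p * F2 p <= 0.
Proof.
move=> c1 c2 A1 A2 D Dx neg; pose Q := (fun y => F1 y * F2 y) @^-1` [set r | r <= 0].
have clQ : closed Q.
  apply: preimage_closed; last exact: closed_le.
  by move=> y _; apply: cvgM; [exact: c1|exact: c2].
have sub : connected_component D x `<=` Q.
  move=> y Dy; rewrite /Q /=.
  have h1 := connected_component_sign c1 A1 Dx Dy.
  have h2 := connected_component_sign c2 A2 Dx Dy.
  have := mulr_gt0 h1 h2; rewrite mulrACA nmulr_rgt0//; exact: ltW.
by move=> /(closureS sub); rewrite -(iffLR (closure_id _) clQ).
Qed.

Lemma residual_continuous (A B e : R) (a : nat) : continuous (residual A B e a).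
Proof.
move=> p; rewrite /residual /tangent.
have c1 : (fun q : R * R => q.1) @ p --> p.1 by exact: cvg_fst.
have c2 : (fun q : R * R => q.2) @ p --> p.2 by exact: cvg_snd.
apply: cvgB; first apply: cvgB => //.
  by apply: cvgD; [apply: cvgM => //|]; exact: cvg_cst.
apply: cvgM; first exact: cvg_cst.
by apply: cvgB; [apply: cvgM => //|]; exact: cvg_cst.
Qed.

Definition res_line (A B e : R) (a : nat) : set (R * R) :=
  [set p | residual A B e a p = 0].

Lemma res_line_is_line (A B e : R) (a : nat) : is_line (res_line A B e a).
Proof.
exists (- (A + e * a%:R)), 1, (B - e * a%:R ^+ 2); split.
  by case=> _ /eqP; rewrite oner_eq0.
apply/seteqP; split=> -[x y]; rewrite /res_line /residual /tangent /= => h; lra.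
Qed.

Lemma res_line_slope (A B A' B' e : R) (a a' : nat) :
  res_line A B e a = res_line A' B' e a' -> A + e * a%:R = A' + e * a'%:R.
Proof.
pose f x := A * x + B + e * tangent a x.
move=> eq_l; have on x : res_line A' B' e a' (x, f x).
  by rewrite -eq_l /res_line /residual /f /=; ring.
by have := on 0; have := on 1; rewrite /res_line /residual /f /tangent /=; lra.
Qed.

End Plane.

(** * The arrangement and its guarding sets *)

(** Each requirement holds for all small [e] and there are finitely many, so one [e] meets them
    all. *)
Lemma quad_lines (R : realType) (C k q m : nat) : (m + m <= C)%N ->
  exists (A B : word C k q -> R) (e : R),
  let G (x : word C k q * 'I_m) := residual (A x.1) (B x.1) e x.2 in
  injective (fun x : word C k q * 'I_m => A x.1 + e * x.2%:R) /\
  forall t s (a b : 'I_m), a != b -> t != s -> agree_off (a + b) t s ->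
    (exists p, G (t, a) p * G (t, b) p < 0 /\ G (s, a) p * G (s, b) p < 0) /\
    (forall p, G (t, a) p * G (t, b) p <= 0 -> G (s, a) p * G (s, b) p <= 0 ->
      forall x, G x p = 0 ->
      ((x.1 == t) || (x.1 == s)) && ((x.2 == a) || (x.2 == b))).
Proof.
move=> mC; have [A [B [A_inj gen]]] := generic_lines R C k q.
set W := word C k q in A B A_inj gen *.
have inj (xy : (W * 'I_m) * (W * 'I_m)) : eventually_small (fun e =>
    A xy.1.1 + e * xy.1.2%:R = A xy.2.1 + e * xy.2.2%:R -> xy.1 = xy.2).
  case: xy => [[t a] [s b]] /=; have [->|ts] := eqVneq t s.
    apply: small_true => e e0 /addrI/(mulfI (lt0r_neq0 e0))/eqP.
    by rewrite eqr_nat => /eqP/val_inj ->.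
  have pos : 0 < `|A t - A s| by rewrite normr_gt0 subr_eq0 (inj_eq A_inj).
  apply: small_imply (small_lt `|b%:R - a%:R| pos) => e e0 h eqA; exfalso.
  have E : A t - A s = e * (b%:R - a%:R) by lra.
  by rewrite E normrM gtr0_norm// ltxx in h.
have quad (i : W * W * ('I_m * 'I_m)) : eventually_small (fun e =>
    let: (t, s, (a, b)) := i in
    let G (x : W * 'I_m) := residual (A x.1) (B x.1) e x.2 in
    a != b -> t != s -> agree_off (a + b) t s ->
    (exists p, G (t, a) p * G (t, b) p < 0 /\ G (s, a) p * G (s, b) p < 0) /\
    (forall p, G (t, a) p * G (t, b) p <= 0 -> G (s, a) p * G (s, b) p <= 0 ->
      forall x, G x p = 0 ->
      ((x.1 == t) || (x.1 == s)) && ((x.2 == a) || (x.2 == b)))).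
  case: i => [[t s] [a b]].
  have [->|ab] := eqVneq a b; first exact: small_true.
  have [->|ts] := eqVneq t s; first exact: small_true.
  have [off|noff] := pselect (agree_off (a + b) t s); last exact: small_true.
  have abC : (a + b < C)%N by rewrite (leq_trans _ mC)// -addnS leq_add// ltnW.
  have [x0 [x1 x2 cross generic]] := gen t s _ abC ts off.
  have At : A t != A s by rewrite (inj_eq A_inj).
  apply: small_imply (small_quad At ab cross x1 x2 generic) => e e0 /= [ex iso] _ _ _.
  by split=> // p h1 h2 [r d]; apply: iso h1 h2 r d.
have [e0 e00 H] := small_and (small_forall inj) (small_forall quad).
have h0 : 0 < e0 / 2 by rewrite divr_gt0.
have h1 : e0 / 2 < e0 by lra.
have [injE quadE] := H _ h0 h1.
exists A, B, (e0 / 2); split=> [x y|t s a b]; first exact: injE (x, y).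
exact: quadE (t, s, (a, b)).
Qed.

Lemma guarding_lower_bound (R : realType) (C k q m n : nat) :
  (m + m <= C)%N -> (m * m <= k)%N -> (n <= #|{: word C k q}| * m)%N ->
  exists A : {fset set (R * R)}, [/\ arrangement A, #|` A| = n &
    forall G, guarding A G -> (n <= #|` G| + 2 * #|{: word C k q}|)%N].
Proof.
move=> mC mk nX; have [A [B [e [slope_inj quad]]]] := quad_lines R k q mC.
set W := word C k q in A B nX slope_inj quad *.
pose l (x : W * 'I_m) : set (R * R) := res_line (A x.1) (B x.1) e x.2.
have l_inj : injective l by move=> x y /res_line_slope/slope_inj.
(* Any [n] of the lines will do: [quad] isolates quadrilaterals from all the lines, hence from those
   kept. *)
pose J : {set W * 'I_m} := [set x in take n (enum {: W * 'I_m})]%SET.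
have cardJ : #|J| = n.
  rewrite cardsE; have /card_uniqP -> := take_uniq n (enum_uniq {: W * 'I_m}).
  by rewrite size_take_min -cardE card_prod card_ord; apply/minn_idPl.
pose L := [fset l x | x in J]%fset.
have lL x : (l x \in L) = (x \in J) by rewrite mem_imfset.
exists L; split.
- by move=> _ /imfsetP[x _ ->]; exact: res_line_is_line.
- by rewrite card_imfset//= -cardE.
move=> G [GL guard]; pose S := [set x in J | l x \notin G]%SET.
have JS : (#|J| <= #|` G| + #|S|)%N.
  rewrite -(cardsID [set x | l x \in G] J); apply: leq_add; last first.
    by apply: subset_leq_card; apply/fintype.subsetP => x; rewrite !inE andbC.
  rewrite cardE -(size_map l); apply: uniq_leq_size.
    by rewrite map_inj_uniq ?enum_uniq.
  by move=> _ /mapP[x + ->]; rewrite mem_enum !inE => /andP[].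
rewrite -cardJ (leq_trans JS)// leq_add2l; apply: card_quad_free => //.
have memS x : (x \in S) = (x \in J) && (l x \notin G) by rewrite inE.
move=> t s a b ab ts off; rewrite !memS.
move=> /andP[tJ tG] /andP[tJ' tG'] /andP[sJ sG] /andP[sJ' sG'].
have [[p [neg1 neg2]] iso] := quad t s a b ab ts off.
pose D := ~` \bigcup_(l in [set` L]) l.
(* A line through [p] would be one of the four, but their residuals are nonzero at [p]. *)
have Dp : D p.
  move=> [_ /imfsetP[x _ ->] xp].
  have /andP[] := iso p (ltW neg1) (ltW neg2) x xp.
  move: neg1 neg2; case: x xp => r d /=; rewrite /l /res_line /= => rd n1 n2.
  by move=> /orP[] /eqP rE /orP[] /eqP dE; subst r d; move: n1 n2;
    rewrite rd ?mul0r ?mulr0 ltxx.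
have [l0 lG [p1 [p2 [_ seg]]]] := guard _ (ex_intro2 _ _ p Dp erefl).
have /imfsetP[x xJ lE] := fsubsetP GL _ lG.
have [] : (l0 `&` boundary (connected_component D p)) p1.
  by apply: seg; exists 0; rewrite /= ?in_itv /= ?lexx ?ler01// subr0 scale1r scale0r addr0.
rewrite lE => xp1 [clp1 _].
have cl (r : W) (c d : 'I_m) : (r, c) \in J -> (r, d) \in J ->
    residual (A r) (B r) e c p * residual (A r) (B r) e d p < 0 ->
    residual (A r) (B r) e c p1 * residual (A r) (B r) e d p1 <= 0.
  rewrite -lL => rc; rewrite -lL => rd neg.
  by apply: closure_component_quad rc rd Dp neg clp1; exact: residual_continuous.
have := iso p1 (cl t a b tJ tJ' neg1) (cl s a b sJ sJ' neg2) x xp1.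
case: x lE {xJ xp1} => r d /= lE /andP[/orP[]/eqP rE /orP[]/eqP dE]; subst r d l0.
- by rewrite lG in tG.
- by rewrite lG in tG'.
- by rewrite lG in sG.
- by rewrite lG in sG'.
Qed.

(** * Choice of parameters and the limit *)

Theorem theorem1 (R : realType) :
  (fun n : nat => (n%:R - (gamma R n)%:R) / n%:R : R) @ \oo --> (0 : R).
Proof.
apply/cvgrPdist_le => eps eps0.
(* A guarding set will miss at most [4 * n / m] lines. *)
set m := Num.bound (4 / eps).
have m_gt : 4 / eps < m%:R.
  by apply: archi_boundP; rewrite divr_ge0// ltW.
have m0 : (0 < m)%N by rewrite -(ltr0n R) (lt_trans _ m_gt)// divr_gt0.
(* The number of lines for [q = 1]. The [q] below is the least with [n < M * q], and [M <= n] then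
   gives [M * q <= 2 * n]. *)
pose M := ((m * m) ^ (m + m) * m)%N.
have M0 : (0 < M)%N by rewrite muln_gt0 expn_gt0 muln_gt0 m0.
exists M => // n /= Mn.
have n0 : (0 < n)%N := leq_trans M0 Mn.
pose q := (n %/ M).+1.
have cW : (#|{: word (m + m) (m * m) q}| * m = M * q)%N.
  by rewrite card_prod card_ffun !card_ord /M -!mulnA [(q * m)%N]mulnC.
have nq : (n <= M * q)%N by rewrite mulnC ltnW// ltn_ceil.
have qn : (M * q <= 2 * n)%N.
  by rewrite /q mulnS mul2n -addnn leq_add// mulnC leq_trunc_div.
have [A [lA cA gA]] := @guarding_lower_bound R (m + m) (m * m) q m n (leqnn _) (leqnn _)
  ltac:(by rewrite cW).
have gam : (n <= gamma R n + 2 * #|{: word (m + m) (m * m) q}|)%N.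
  apply: (@leq_trans (guard_num A + 2 * #|{: word (m + m) (m * m) q}|)%N).
    (* The default value of the minimum is [n], which satisfies the bound as well. *)
    rewrite /guard_num; elim/big_rec: _ => [|S j /asboolP/gA hS IH].
      by rewrite cA leq_addr.
    by case: (leqP #|` S| j).
  by rewrite leq_add2r; apply: (gammaP R n).2.
have gn : (gamma R n <= n)%N.
  by have [[B [_ <- <-]] _] := gammaP R n; exact: guard_num_le.
have nR : 0 < n%:R :> R by rewrite ltr0n.
rewrite sub0r normrN ger0_norm; last by rewrite divr_ge0// subr_ge0 ler_nat.
rewrite ler_pdivrMr// -(ler_pM2l (_ : 0 < m%:R)) ?ltr0n//.
have : (m * (n - gamma R n) <= 4 * n)%N.
  have : (n - gamma R n <= 2 * #|{: word (m + m) (m * m) q}|)%N by rewrite leq_subLR.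
  move=> /(leq_mul (leqnn m)) h; apply: (leq_trans h).
  by rewrite mulnCA [(m * _)%N]mulnC cW -[4%N]/(2 * 2)%N -mulnA leq_pmul2l.
rewrite -(ler_nat R) !natrM natrB// => h; apply: (le_trans h).
rewrite mulrA ler_pM2r//; move: m_gt; rewrite ltr_pdivrMr// => /ltW.
by [].
Qed.
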